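(* Let $\Sigma$ be a finite set of atoms and let $S$ be a total-closed set of here-and-there interpretations over $\Sigma$. Then $S$ is exactly the set of countermodels of the nonnested logic program $$\Pi(S) := \{\, r_{X,Y} \mid (X,Y)\in S \,\}.$$
   Context: Propositional formulas over $\Sigma$ are built from atoms with $\bot,\vee,\wedge,\to$; $\neg F := F\to\bot$ and $\top:=\bot\to\bot$. A classical interpretation is a set $Y\subseteq\Sigma$ of true atoms; $Y\models F$ is classical satisfaction. A here-and-there (HT) interpretation is a pair $(X,Y)$ with $X\subseteq Y\subseteq\Sigma$; it is total if $X=Y$. Satisfaction: $(X,Y)\models a$ iff $a\in X$ for an atom $a$; $(X,Y)\not\models\bot$; $\wedge$ and $\vee$ are interpreted pointwise ($(X,Y)$ satisfies both, resp. at least one, of the components); $(X,Y)\models F\to G$ iff both ($(X,Y)\models F$ implies $(X,Y)\models G$) and $Y\models F\to G$ classically. An interpretation is a model of a set of formulas if it satisfies all of them, and a countermodel otherwise. A literal is an atom $a$ or its negation $\neg a$. A nonnested rule is a formula $(l_1\wedge\dots\wedge l_m)\to(l_{m+1}\vee\dots\vee l_n)$ with $0\le m\le n$ and all $l_i$ literals; an empty conjunction is $\top$ and an empty disjunction is $\bot$. A nonnested logic program is a set of nonnested rules. For an HT interpretation $(X,Y)$ over $\Sigma$, $r_{X,Y}$ is the nonnested rule $$\Big(\bigwedge_{b\in X} b\Big)\wedge\Big(\bigwedge_{c\in\Sigma\setminus Y}\neg c\Big)\ \to\ \bigvee_{a\in Y\setminus X}(a\vee\neg a)$$ (the head is $\bot$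 when $X=Y$). A set $S$ of HT interpretations is total-closed if, whenever $(Y,Y)\in S$, also $(X,Y)\in S$ for every $X\subseteq Y$. *)

(* Defs.v *)
From HB Require Import structures.
From mathcomp Require Import all_boot.

Set Implicit Arguments.
Unset Strict Implicit.
Unset Printing Implicit Defensive.

Inductive formula (A : Type) : Type :=
| Atom of A
| Bot
| Or of formula A & formula A
| And of formula A & formula A
| Imp of formula A & formula A.

Arguments Bot {A}.

Definition Not (A : Type) (F : formula A) : formula A := Imp F Bot.
Definition Top {A : Type} : formula A := Imp Bot Bot.

(* Iterated connectives associate to the right; no unit is appended to a
   nonempty list. *)
Fixpoint conj_seq (A : Type) (s : seq (formula A)) : formula A :=
  match s with
  | [::] => Top
  | [:: F] => F
  | F :: s' => And F (conj_seq s')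
  end.

Fixpoint disj_seq (A : Type) (s : seq (formula A)) : formula A :=
  match s with
  | [::] => Bot
  | [:: F] => F
  | F :: s' => Or F (disj_seq s')
  end.

Inductive literal (A : Type) : Type := Pos of A | Neg of A.

Definition lit_formula (A : Type) (l : literal A) : formula A :=
  match l with Pos a => Atom a | Neg a => Not (Atom a) end.

Definition rule_formula (A : Type) (body head : seq (literal A)) : formula A :=
  Imp (conj_seq (map (@lit_formula A) body))
      (disj_seq (map (@lit_formula A) head)).

Definition nonnested_rule (A : Type) (F : formula A) : Prop :=
  exists body head : seq (literal A), F = rule_formula body head.

Definition nonnested_program (A : Type) (P : formula A -> Prop) : Prop :=
  forall F, P F -> nonnested_rule F.

Fixpoint csat (A : finType) (Y : {set A}) (F : formula A) : bool :=
  match F with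
  | Atom a => a \in Y
  | Bot => false
  | Or G H => csat Y G || csat Y H
  | And G H => csat Y G && csat Y H
  | Imp G H => csat Y G ==> csat Y H
  end.

(* A single field, so that the finType structure is inherited from pairs. *)
Record ht_interp (A : finType) : Type := HTInterp {
  ht_pair : {set A} * {set A};
  _ : ht_pair.1 \subset ht_pair.2
}.

HB.instance Definition _ (A : finType) := [isSub for @ht_pair A].
HB.instance Definition _ (A : finType) := [Finite of ht_interp A by <:].

Definition here (A : finType) (I : ht_interp A) : {set A} := (ht_pair I).1.
Definition there (A : finType) (I : ht_interp A) : {set A} := (ht_pair I).2.

Definition mk_ht (A : finType) (X Y : {set A}) (sXY : X \subset Y) :
  ht_interp A := @HTInterp A (X, Y) sXY.

Definition total_ht (A : finType) (Y : {set A}) : ht_interp A :=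
  mk_ht (subxx Y).

Fixpoint ht_sat (A : finType) (I : ht_interp A) (F : formula A) : bool :=
  match F with
  | Atom a => a \in here I
  | Bot => false
  | Or G H => ht_sat I G || ht_sat I H
  | And G H => ht_sat I G && ht_sat I H
  | Imp G H => (ht_sat I G ==> ht_sat I H) && csat (there I) (Imp G H)
  end.

Definition ht_model (A : finType) (P : formula A -> Prop) (I : ht_interp A) :
  Prop := forall F, P F -> ht_sat I F.

Definition ht_countermodel (A : finType) (P : formula A -> Prop)
  (I : ht_interp A) : Prop := ~ ht_model P I.

Definition total_closed (A : finType) (S : {set ht_interp A}) : Prop :=
  forall Y : {set A}, total_ht Y \in S ->
  forall (X : {set A}) (sXY : X \subset Y), mk_ht sXY \in S.

(* The head, the disjunction of a \/ ~ a for a in Y \ X, is flattened into a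
   single disjunction of literals; conjuncts and disjuncts are listed in the
   order given by [enum]. *)
Definition ht_rule (A : finType) (I : ht_interp A) : formula A :=
  rule_formula
    ([seq Pos b | b <- enum (here I)] ++ [seq Neg c | c <- enum (~: there I)])
    (flatten [seq [:: Pos a; Neg a] | a <- enum (there I :\: here I)]).

Definition ht_program (A : finType) (S : {set ht_interp A}) :
  formula A -> Prop := fun F => exists2 I, I \in S & F = ht_rule I.

(* Main.v *)
Require Import Defs.
From mathcomp Require Import all_boot.

(** An interpretation J satisfies the body of r_{X,Y} but not its head exactly
    when J = (X,Y). As classical satisfaction in V is HT satisfaction in (V,V),
    J = (U,V) is a countermodel of r_{X,Y} exactly when (X,Y) is (U,V) or (V,V);
    total closure of S is what absorbs the second case. *)

Section HereAndThere.

Variable A : finType.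
Implicit Types (I J : ht_interp A) (Y : {set A}) (F : formula A)
  (s : seq (formula A)) (l : literal A).

Lemma here_sub_there I : here I \subset there I.
Proof. by case: I. Qed.

Lemma ht_interp_eqE I J : (I == J) = (here I == here J) && (there I == there J).
Proof. by rewrite -val_eqE; case: I J => [[? ?] ?] [[? ?] ?]. Qed.

Lemma ht_sat_total Y F : ht_sat (total_ht Y) F = csat Y F.
Proof.
elim: F => //= [F IHF G IHG|F IHF G IHG|F IHF G IHG]; rewrite IHF IHG //.
by rewrite andbb.
Qed.

Lemma ht_sat_conj_seq J s : ht_sat J (conj_seq s) = all (ht_sat J) s.
Proof.
by elim: s => //= F [|G s] IHs; rewrite ?andbT //= -/(conj_seq (G :: s)) IHs.
Qed.

Lemma ht_sat_disj_seq J s : ht_sat J (disj_seq s) = has (ht_sat J) s.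
Proof.
by elim: s => //= F [|G s] IHs; rewrite ?orbF //= -/(disj_seq (G :: s)) IHs.
Qed.

(** For [Neg a], the HT clause requires [a] to be outside both [here J] and [there J]; since
    [here J] lies in [there J], the latter suffices. *)
Lemma ht_sat_lit J l :
  ht_sat J (lit_formula l) =
  match l with Pos a => a \in here J | Neg a => a \notin there J end.
Proof.
case: l => //= a; rewrite !implybF andb_idl //.
exact/contra/(subsetP (here_sub_there J)).
Qed.

Definition ht_body I :=
  [seq Pos b | b <- enum (here I)] ++ [seq Neg c | c <- enum (~: there I)].

Definition ht_head I :=
  flatten [seq [:: Pos a; Neg a] | a <- enum (there I :\: here I)].

Lemma all_enum_mem (B C : {set A}) : all [in C] (enum B) = (B \subset C).
Proof. by rewrite -(eq_subset (mem_enum B)) subset_all. Qed.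

Lemma ht_sat_body J I :
  ht_sat J (conj_seq (map (@lit_formula A) (ht_body I))) =
  (here I \subset here J) && (there J \subset there I).
Proof.
rewrite ht_sat_conj_seq all_map (eq_all (ht_sat_lit J)) all_cat !all_map.
rewrite -[there J \subset _]setCS -!all_enum_mem.
by congr (_ && _); apply: eq_all => a /=; rewrite inE.
Qed.

(** The pair [Pos a], [Neg a] fails in [J] exactly when [a] lies in [there J :\: here J], so the
    head fails when this holds for all its atoms. *)
Lemma ht_sat_head J I :
  ht_sat J (disj_seq (map (@lit_formula A) (ht_head I))) =
  ~~ (there I :\: here I \subset there J :\: here J).
Proof.
rewrite ht_sat_disj_seq has_map (eq_has (ht_sat_lit J)) -all_enum_mem /ht_head.
by elim: (enum _) => //= a s ->; rewrite inE !negb_and negbK orbA.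
Qed.

Lemma ht_countermodel_rule J I :
  ~~ ht_sat J (ht_rule I) = (I == J) || (I == total_ht (there J)).
Proof.
(* Stated for arbitrary [K], as it serves for both [J] and [total_ht (there J)]. *)
have unsat K : ~~ (ht_sat K (conj_seq (map (@lit_formula A) (ht_body I))) ==>
    ht_sat K (disj_seq (map (@lit_formula A) (ht_head I)))) = (I == K).
  rewrite negb_imply ht_sat_body ht_sat_head negbK ht_interp_eqE !eqEsubset.
  apply/idP/idP => [/andP[/andP[sIKh sKIt] /subsetP sD]|].
    rewrite sIKh sKIt andbT /=; apply/andP; split; apply/subsetP => a.
      (* If [a] were outside [here I], it would still be in [there I] through [there K], and [sD]
         would expel it from [here K]. *)
      move=> Ka; apply: contraLR (Ka) => nIa.
      have /sD : a \in there I :\: here I.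
        by rewrite inE nIa (subsetP sKIt) ?(subsetP (here_sub_there K)).
      by rewrite inE => /andP[].
    move=> Ia; have [/(subsetP sIKh)|nIa] := boolP (a \in here I).
      exact/subsetP/here_sub_there.
    by have /sD : a \in there I :\: here I; rewrite inE ?nIa // => /andP[].
  case/andP => /andP[sIKh sKIh] /andP[sIKt sKIt].
  by rewrite sIKh sKIt setDSS.
(* The classical conjunct of [Imp] becomes HT satisfaction in [total_ht (there J)]. *)
by rewrite /= negb_and unsat -!ht_sat_total unsat.
Qed.

End HereAndThere.

Theorem theorem2 (Sigma : finType) (S : {set ht_interp Sigma})
  (hS : total_closed S) :
  nonnested_program (ht_program S) /\
  (forall I : ht_interp Sigma, I \in S <-> ht_countermodel (ht_program S) I).
Proof.
split=> [F [I _ ->]|J]; first by exists (ht_body _ I), (ht_head _ I).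
split=> [SJ /(_ _ (ex_intro2 _ _ J SJ erefl))|cmJ].
  by apply/negP; rewrite ht_countermodel_rule eqxx.
have [//|nSJ] := boolP (J \in S); case: cmJ => _ [I SI ->].
apply: contraNT nSJ; rewrite ht_countermodel_rule => /orP[]/eqP eI.
  by rewrite -eI.
rewrite {}eI in SI.
(* [J] is put in the form in which total closure yields it from [total_ht (there J)]. *)
have /eqP-> : J == mk_ht (here_sub_there _ J) by rewrite ht_interp_eqE !eqxx.
exact: hS SI _ _.
Qed.
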